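(* Let $p_t$ be the density of $X_t$, solving the Fokker-Planck equation $\partial_t p_t=\mathcal L_t^* p_t$, and let $c=(c_1,\dots,c_n)$ be the vector of sufficient statistics of the exponential family $\mathrm{EF}(c)=\{p(\cdot,\theta):\theta\in\Theta\}$. Suppose that $c_1,\dots,c_n$ are eigenfunctions of the backward operator, i.e. $\mathcal L_t c=-\Lambda c$ for all $t\ge 0$, where $\Lambda$ is a constant $n\times n$ real diagonal matrix, and that with this choice of $c$ the set $\mathrm{EF}(c)$ is an exponential family. Suppose the initial density is $p_0=p(\cdot,\theta_0)$ with $\theta_0\in\Theta$. Let $t\mapsto\theta_t\in\Theta$ be the solution, on its interval of existence, of the Fisher-Rao projected equation $$\dot\theta_t=g^{-1}(\theta_t)\,E_{\theta_t}[\mathcal L_t c]$$ started at $\theta_0$. Then, for every $t$ in this interval, $p(\cdot,\theta_t)$ is the best approximation of $p_t$ in $\mathrm{EF}(c)$ in Kullback-Leibler divergence (the ''maximum likelihood estimator'' of $p_t$ in $\mathrm{EF}(c)$): $$D\big(p_t\,\|\,p(\cdot,\theta_t)\big)\le D\big(p_t\,\|\,p(\cdot,\theta)\big)\qquad\text{for all }\theta\in\Theta .$$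
   Context: Diffusion. $X$ solves the Itô SDE $dX_t=f_t(X_t)\,dt+\sigma_t(X_t)\,dW_t$ in $\mathbb R^N$, with $W$ an $M$-dimensional standard Brownian motion, $f_t$ an $N$-vector, $\sigma_t$ an $N\times M$ matrix, $a_t=\sigma_t\sigma_t'$. Assumptions: (A) $X_0$ is independent of $W$ and has an almost everywhere positive Lebesgue density $p_0$ with finite moments of every order. (B) $f$ is once continuously differentiable in $x$ and continuous in $t$; $a$ is twice continuously differentiable in $x$ and continuous in $t$. (C) There is $K>0$ with $2x'f_t(x)+\|a_t(x)\|\le K(1+|x|^2)$ for all $t\ge0$, $x\in\mathbb R^N$. (D) $X_t$ has a density $p_t(x)$ which is $C^{2}$ in $x$ and $C^1$ in $t$, is positive for all $t\ge 0$ and almost all $x$, and satisfies $\partial_t p_t=\mathcal L_t^*p_t$. Operators: $\mathcal L_t=\sum_i f_i\,\partial_{x_i}+\frac12\sum_{i,j}a_{ij}\,\partial^2_{x_ix_j}$, and $\mathcal L_t^*p=-\sum_i\partial_{x_i}(f_ip)+\frac12\sum_{i,j}\partial^2_{x_ix_j}(a_{ij}p)$ (time arguments of $f$, $a$ suppressed). Operators and integrals are applied componentwise to vector functions. Exponential family. $c=(c_1,\dots,c_n)$, $c_i:\mathbb R^N\to\mathbb R$, $p(x,\theta)=\exp(\theta^Tc(x)-\psi(\theta))$ is a probability density with respect to Lebesgue measure for $\theta\in\Theta$, where $\Theta\subset\mathbb R^n$ is a maximal convex open set. $E_\theta$ is expectation under $p(\cdot,\theta)$, and $g(\theta)=[\mathrm{Cov}_{p(\cdot,\theta)}(c_i,c_j)]_{ij}=\mathrm{Hess}\,\psi(\theta)$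 is the Fisher information matrix, assumed invertible. (E) $c\in C^2$. (F) $E_\theta\big[\big(\mathcal L_t^*p(\cdot,\theta)/p(\cdot,\theta)\big)^2\big]<\infty$ for all $\theta\in\Theta$, $t\ge0$. Duality convention. $\mathcal L_t^*$ is the dual of $\mathcal L_t$ in the sense that, for $p=p(\cdot,\theta)$ and for $p=p_t$, all integrals below are finite and $\int c_i\,\mathcal L_t^*p\,dx=\int p\,\mathcal L_tc_i\,dx$; moreover $E_{p_t}[c]$ is finite, continuous in $t$ and differentiable, with $\frac{d}{dt}E_{p_t}[c]=\int c\,\partial_tp_t\,dx=E_{p_t}[\mathcal L_tc]$. Kullback-Leibler divergence: $D(p\|q)=\int p\log\frac pq\,dx\in[0,\infty]$. *)

(* Defs.v *)
From HB Require Import structures.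
From mathcomp Require Import all_boot all_order all_algebra.
From mathcomp Require Import all_classical all_reals all_analysis.

Set Implicit Arguments.
Unset Strict Implicit.
Unset Printing Implicit Defensive.

Import Order.TTheory GRing.Theory Num.Theory.
Import numFieldNormedType.Exports.

Local Open Scope classical_set_scope.
Local Open Scope ring_scope.

Fact matrix_display : measure_display. Proof. exact: default_measure_display. Qed.

Section matrix_measurable.
Context (R : realType) (m n : nat).

(* The sigma-algebra generated by the entries, i.e. the product Borel
   sigma-algebra; it is the Borel sigma-algebra of the normed space 'M[R]_(m, n). *)
Definition mx_cylinders : set (set 'M[R]_(m, n)) :=
  [set B | exists (i : 'I_m) (j : 'I_n) (A : set R), measurable A /\ B = [set x : 'M[R]_(m, n) | A (x i j)]].

HB.instance Definition _ := @isMeasurable.Build matrix_display 'M[R]_(m, n)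
  <<s mx_cylinders >> (@sigma_algebra0 _ setT mx_cylinders)
  (@sigma_algebraC _ mx_cylinders) (@sigma_algebra_bigcup _ setT mx_cylinders).

Lemma measurable_entry i j :
  measurable_fun setT (fun x : 'M[R]_(m, n) => x i j).
Proof.
by move=> _ A mA; rewrite setTI; apply: sub_sigma_algebra; exists i, j, A.
Qed.

Lemma measurable_fun_mx d (T : measurableType d) (f : T -> 'M[R]_(m, n)) :
  (forall i j, measurable_fun setT (fun t => f t i j)) -> measurable_fun setT f.
Proof.
move=> mf.
suff: <<s mx_cylinders >> `<=` [set B | measurable (f @^-1` B)].
  by move=> + _ B mB; rewrite setTI; exact.
apply: smallest_sub.
  split => /=.
  - by rewrite preimage_set0.
  - by move=> A mA; rewrite setTD -preimage_setC; exact: measurableC.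
  - by move=> F mF; rewrite preimage_bigcup; exact: bigcup_measurable.
move=> _ [i [j [A [mA ->]]]] /=.
by have := mf i j measurableT A mA; rewrite setTI.
Qed.

End matrix_measurable.

Section lebesgue_cV.
Context (R : realType).

Definition cV_cons n (u : measurableTypeR R * 'cV[R]_n) : 'cV[R]_n.+1 :=
  col_mx (u.1%:M : 'cV[R]_1) u.2.

Lemma measurable_cV_cons n : measurable_fun setT (@cV_cons n).
Proof.
apply: measurable_fun_mx => i j.
have [k ->|k ->] := split_ordP (i : 'I_(1 + n)).
  rewrite (_ : (fun _ => _) = fst); first exact: measurable_fst.
  apply/funext => u; rewrite /cV_cons.
  by rewrite (@col_mxEu _ 1 n 1 u.1%:M u.2) !ord1 mxE eqxx mulr1n.
rewrite (_ : (fun _ => _) = (fun x : 'cV[R]_n => x k j) \o snd).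
  apply: measurableT_comp; [exact: measurable_entry|exact: measurable_snd].
by apply/funext => u; rewrite /cV_cons (@col_mxEd _ 1 n 1 u.1%:M u.2).
Qed.

Section step.
Context n (mu : {sigma_finite_measure set 'cV[R]_n -> \bar R}).

Definition lebesgue_cV_step :=
  pushforward (@lebesgue_measure R \x mu)%E (@cV_cons n).

Let step0 : lebesgue_cV_step set0 = 0%E.
Proof. by rewrite /lebesgue_cV_step /pushforward preimage_set0 measure0. Qed.

Let step_ge0 A : (0 <= lebesgue_cV_step A)%E.
Proof. exact: (measure_ge0 (@lebesgue_measure R \x mu)%E). Qed.

Let step_sigma_additive : semi_sigma_additive lebesgue_cV_step.
Proof.
move=> F mF tF mUF; rewrite /lebesgue_cV_step /pushforward preimage_bigcup.
have mpre B : measurable B -> measurable (@cV_cons n @^-1` B).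
  by move=> mB; rewrite -[X in measurable X]setTI; exact: measurable_cV_cons.
apply: measure_semi_sigma_additive => [k||].
- by apply: mpre; exact: mF.
- apply/trivIsetP => /= i j _ _ ij; rewrite -preimage_setI.
  by move/trivIsetP : tF => /(_ _ _ _ _ ij) ->//; rewrite preimage_set0.
- by rewrite -preimage_bigcup; exact: mpre.
Qed.

HB.instance Definition _ := isMeasure.Build _ _ _
  lebesgue_cV_step step0 step_ge0 step_sigma_additive.

Let step_sigma_finite : sigma_finite setT lebesgue_cV_step.
Proof.
have /sigma_finiteP[F [TF ndF Foo]] := sigma_finiteT (@lebesgue_measure R).
have /sigma_finiteP[G [TG ndG Goo]] := sigma_finiteT mu.
pose g (x : 'cV[R]_n.+1) : measurableTypeR R * 'cV[R]_n :=
  (x ord0 ord0, dsubmx (x : 'cV[R]_(1 + n))).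
have gK : cancel (@cV_cons n) g.
  move=> [a v]; rewrite /g /cV_cons /= col_mxKd; congr pair.
  rewrite (_ : ord0 = lshift n (ord0 : 'I_1)); last exact/val_inj.
  by rewrite (@col_mxEu _ 1 n 1 a%:M v) mxE eqxx mulr1n.
have mg : measurable_fun setT g.
  apply: measurable_fun_pair; first exact: measurable_entry.
  apply: measurable_fun_mx => i j.
  rewrite (_ : (fun _ => _) = fun x : 'cV[R]_n.+1 => x (rshift 1 i) j).
    exact: measurable_entry.
  by apply/funext => x; rewrite mxE.
exists (fun k => g @^-1` (F k `*` G k)).
  rewrite -preimage_bigcup (_ : \bigcup_k (F k `*` G k) = setT) ?preimage_setT//.
  rewrite -subTset => -[x y] _.
  have [k _ Fkx] : (\bigcup_k F k) x by rewrite -TF.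
  have [l _ Gly] : (\bigcup_k G k) y by rewrite -TG.
  exists (maxn k l) => //; split => /=.
    by move: x Fkx; exact/subsetPset/ndF/leq_maxl.
  by move: y Gly; exact/subsetPset/ndG/leq_maxr.
move=> k; have [mF Fk] := Foo k; have [mG Gk] := Goo k; split.
  by rewrite -[X in measurable X]setTI; apply: mg => //; exact: measurableX.
rewrite /lebesgue_cV_step /pushforward -comp_preimage.
rewrite (_ : g \o _ = id); last by rewrite funeqE => u /=; rewrite gK.
by rewrite product_measure1E// lte_mul_pinfty// ge0_fin_numE.
Qed.

HB.instance Definition _ := Measure_isSigmaFinite.Build _ _ _
  lebesgue_cV_step step_sigma_finite.

End step.

Fixpoint lebesgue_cV n : {sigma_finite_measure set 'cV[R]_n -> \bar R} :=
  match n with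
  | 0 => \d_(0 : 'cV[R]_0)
  | n'.+1 => lebesgue_cV_step (lebesgue_cV n')
  end.

Lemma lebesgue_cV_box n (A : 'I_n -> set R) :
  (forall i, measurable (A i)) ->
  lebesgue_cV n [set x | forall i, A i (x i ord0)] =
  (\prod_(i < n) lebesgue_measure (A i))%E.
Proof.
elim: n A => [|n IHn] A mA.
  rewrite big_ord0 /= diracE mem_set//= => i; by case: i.
rewrite big_ord_recl -IHn//=.
have mB : measurable [set x : 'cV[R]_n | forall i, A (lift ord0 i) (x i ord0)].
  rewrite (_ : [set x : 'cV[R]_n | _] = \bigcap_(i in [set: 'I_n])
      [set x : 'cV[R]_n | A (lift ord0 i) (x i ord0)]); last first.
    by apply/seteqP; split=> [x h i _|x h i]; exact: h.
  apply: fin_bigcap_measurable => [|i _]; first exact: finite_finset.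
  by rewrite -[X in measurable X]setTI; exact: measurable_entry.
rewrite -product_measure1E//; [|exact: mA].
rewrite /lebesgue_cV_step /pushforward; congr (_ _).
apply/seteqP; split=> -[a v] /=; rewrite /cV_cons.
  move=> h; split.
    have := h ord0; rewrite (_ : ord0 = lshift n (ord0 : 'I_1)); last exact/val_inj.
    by rewrite (@col_mxEu _ 1 n 1 a%:M v) mxE eqxx mulr1n.
  move=> i; have := h (lift ord0 i).
  rewrite [in X in A _ X](_ : lift ord0 i = rshift 1 i); last exact/val_inj.
  by rewrite (@col_mxEd _ 1 n 1 a%:M v).
move=> [h0 h] i; have [k ->|k ->] := split_ordP (i : 'I_(1 + n)).
  rewrite (@col_mxEu _ 1 n 1 a%:M v) !ord1 mxE eqxx mulr1n.
  by rewrite (_ : lshift n (ord0 : 'I_1) = ord0 :> 'I_(1 + n)) //; exact/val_inj.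
rewrite (@col_mxEd _ 1 n 1 a%:M v) (_ : rshift 1 k = lift ord0 k :> 'I_(1 + n)) //.
exact/val_inj.
Qed.

End lebesgue_cV.

Section calculus.
Context (R : realType).

Definition halfline : set R := [set t | 0 <= t].

(* Derivative relative to a set D of times; at an end point of an interval it is
   the one-sided derivative. *)
Definition derivable_within (V : normedModType R) (D : set R) (u : R -> V)
    (t : R) : Prop :=
  cvg ((fun s => (s - t)^-1 *: (u s - u t)) @ within D (t^')).

Definition derive_within (V : normedModType R) (D : set R) (u : R -> V)
    (t : R) : V :=
  lim ((fun s => (s - t)^-1 *: (u s - u t)) @ within D (t^')).

Definition partial N (i : 'I_N) (h : 'cV[R]_N -> R) (x : 'cV[R]_N) : R :=
  'D_(delta_mx i ord0) h x.

Definition C1 N (h : 'cV[R]_N -> R) : Prop := forall i : 'I_N,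
  (forall x, derivable h x (delta_mx i ord0)) /\ continuous (partial i h).

Definition C2 N (h : 'cV[R]_N -> R) : Prop :=
  C1 h /\ forall i : 'I_N, C1 (partial i h).

Definition enorm N (x : 'cV[R]_N) : R := Num.sqrt (\sum_i x i ord0 ^+ 2).

End calculus.

Section stochastic.
Context (R : realType) d (Om : measurableType d) (P : probability Om R).

Record filtration (F : R -> set (set Om)) : Prop := {
  filtration_sigma_algebra : forall t, 0 <= t -> sigma_algebra setT (F t);
  filtration_measurable : forall t, 0 <= t -> F t `<=` measurable;
  filtration_nondecreasing : forall s t, 0 <= s -> s <= t -> F s `<=` F t
}.

Definition adapted (F : R -> set (set Om)) d' (E : measurableType d')
    (Y : R -> Om -> E) : Prop := forall t, 0 <= t ->
  measurable_fun setT (Y t : g_sigma_algebraType (F t) -> E).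

Definition progressive (F : R -> set (set Om)) (H : R -> Om -> R) : Prop :=
  forall t, 0 <= t -> measurable_fun
    ([set s : R | 0 <= s <= t] `*` [set: g_sigma_algebraType (F t)])
    (fun u => H u.1 u.2).

Record brownian_motion (F : R -> set (set Om)) M (W : R -> Om -> 'cV[R]_M) :
    Prop := {
  brownian_adapted : adapted F W;
  brownian_start : {ae P, forall w, W 0 w = 0};
  brownian_continuous :
    {ae P, forall w, {within @halfline R, continuous (W ^~ w)}};
  brownian_independent_increments : forall (s t : R) A B, 0 <= s -> s <= t ->
    F s A -> measurable B ->
    P (A `&` [set w | B (W t w - W s w)]) =
    (P A * P [set w | B (W t w - W s w)%R])%E;
  brownian_gaussian_increments : forall (s t : R) (B : 'I_M -> set R),
    0 <= s -> s < t -> (forall j, measurable (B j)) ->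
    P [set w | forall j, B j (W t w j ord0 - W s w j ord0)] =
    (\prod_(j < M) normal_prob 0 (Num.sqrt (t - s)) (B j))%E
}.

(* The process s |-> \sum_k sp_val k * 1_{]sp_left k, sp_right k]}(s). *)
Record simple_process : Type := SimpleProcess {
  sp_size : nat;
  sp_left : 'I_sp_size -> R;
  sp_right : 'I_sp_size -> R;
  sp_val : 'I_sp_size -> Om -> R
}.

Definition predictable (F : R -> set (set Om)) (S : simple_process) : Prop :=
  forall k : 'I_(sp_size S), [/\ 0 <= sp_left k, sp_left k <= sp_right k,
    measurable_fun setT (sp_val k : g_sigma_algebraType (F (sp_left k)) -> R)
    & exists C, forall w, `|sp_val k w| <= C].

Definition simple_value (S : simple_process) (s : R) (w : Om) : R :=
  \sum_(k < sp_size S) sp_val k w * (sp_left k < s <= sp_right k)%R%:R.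

Definition simple_integral (S : simple_process) (B : R -> Om -> R) (t : R)
    (w : Om) : R :=
  \sum_(k < sp_size S) sp_val k w *
    (B (Num.min (sp_right k) t) w - B (Num.min (sp_left k) t) w).

Definition cvg_to0_in_probability (Z : nat -> Om -> \bar R) : Prop :=
  forall e : R, 0 < e -> (fun k => P [set w | e%:E <= `|Z k w|]%E) @ \oo --> 0%E.

(* The Ito integral is the limit in probability of the integrals of simple
   processes S k with \int_0^t (S k - H)^2 ds -> 0 in probability; being required
   to be continuous, I is determined up to indistinguishability. *)
Definition is_ito_integral (F : R -> set (set Om)) (B H I : R -> Om -> R) :
    Prop :=
  [/\ progressive F H,
      {ae P, forall w, forall t : R, 0 <= t ->
        (\int[lebesgue_measure]_(s in `[0%R, t]) ((H s w) ^+ 2)%:E < +oo)%E},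
      {ae P, forall w, {within @halfline R, continuous (I ^~ w)}}
    & exists S : nat -> simple_process, (forall k, predictable F (S k)) /\
        forall t, 0 <= t ->
          cvg_to0_in_probability (fun k w =>
            \int[lebesgue_measure]_(s in `[0%R, t])
              ((simple_value (S k) s w - H s w) ^+ 2)%:E)%E /\
          cvg_to0_in_probability (fun k w =>
            (simple_integral (S k) B t w - I t w)%:E)].

Definition ito_sde N M (f : R -> 'cV[R]_N -> 'cV[R]_N)
    (sigma : R -> 'cV[R]_N -> 'M[R]_(N, M)) (W : R -> Om -> 'cV[R]_M)
    (X : R -> Om -> 'cV[R]_N) : Prop :=
  exists F, [/\ filtration F, brownian_motion F W, adapted F X,
    {ae P, forall w, {within @halfline R, continuous (X ^~ w)}} &
    {ae P, forall w, forall (t : R) i, 0 <= t ->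
      lebesgue_measure.-integrable `[0, t]
        (fun s => (f s (X s w) i ord0)%:E)} /\
    exists I : 'I_N -> 'I_M -> R -> Om -> R,
      (forall i j, is_ito_integral F (fun t w => W t w j ord0)
        (fun t w => sigma t (X t w) i j) (I i j)) /\
      {ae P, forall w, forall (t : R) i, 0 <= t ->
        X t w i ord0 = X 0 w i ord0
          + \int[lebesgue_measure]_(s in `[0, t]) f s (X s w) i ord0
          + \sum_j I i j t w}].

Definition independent_of_process d1 (E1 : measurableType d1) d2
    (E2 : measurableType d2) (Y : Om -> E1) (W : R -> Om -> E2) : Prop :=
  forall A B, measurable A ->
    <<s [set C | exists t D,
           [/\ 0 <= t, measurable D & C = W t @^-1` D]] >> B ->
    P (Y @^-1` A `&` B) = (P (Y @^-1` A) * P B)%E.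

End stochastic.

Section densities.
Context (R : realType) (N : nat).
Local Notation mu := (lebesgue_cV R N).
Implicit Types (p q h : 'cV[R]_N -> R).

Definition is_density p : Prop :=
  [/\ measurable_fun setT p, forall x, 0 <= p x
    & (\int[mu]_x (p x)%:E = 1)%E].

Definition has_density d (Om : measurableType d) (P : probability Om R)
    (Y : Om -> 'cV[R]_N) p : Prop :=
  is_density p /\
  forall A, measurable A -> P (Y @^-1` A) = (\int[mu]_(x in A) (p x)%:E)%E.

Definition finite_moments p : Prop :=
  forall k : nat, (\int[mu]_x (enorm x ^+ k * p x)%:E < +oo)%E.

Definition dexpect p h : R := \int[mu]_x (h x * p x).

Definition dexpect_cV n p (h : 'cV[R]_N -> 'cV[R]_n) : 'cV[R]_n :=
  \col_i dexpect p (fun x => h x i ord0).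

Definition dcov p h h' : R :=
  dexpect p (fun x => (h x - dexpect p h) * (h' x - dexpect p h')).

(* For densities the integrand is at least p - q where q > 0, so its negative part
   is integrable and the extended integral is meaningful. *)
Definition KL p q : \bar R := (\int[mu]_x (p x * ln (p x / q x))%:E)%E.

End densities.

Section diffusion.
Context (R : realType) (N M : nat).
Local Notation mu := (lebesgue_cV R N).
Implicit Types (f : R -> 'cV[R]_N -> 'cV[R]_N) (a : R -> 'cV[R]_N -> 'M[R]_N).

Definition diffusion_mx (sigma : R -> 'cV[R]_N -> 'M[R]_(N, M)) (t : R)
  (x : 'cV[R]_N) : 'M[R]_N := sigma t x *m (sigma t x)^T.

Definition backward f a t (h : 'cV[R]_N -> R) (x : 'cV[R]_N) : R :=
  \sum_i f t x i ord0 * partial i h x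
  + 2^-1 * \sum_i \sum_j a t x i j * partial i (partial j h) x.

Definition backward_cV f a t n (h : 'cV[R]_N -> 'cV[R]_n) (x : 'cV[R]_N) :
    'cV[R]_n :=
  \col_k backward f a t (fun y => h y k ord0) x.

Definition forward f a t (p : 'cV[R]_N -> R) (x : 'cV[R]_N) : R :=
  - \sum_i partial i (fun y => f t y i ord0 * p y) x
  + 2^-1 * \sum_i \sum_j partial i (partial j (fun y => a t y i j * p y)) x.

Record regular_coefficients f a : Prop := {
  drift_C1 : forall t i, 0 <= t -> C1 (fun x => f t x i ord0);
  drift_continuous : forall x, {within @halfline R, continuous (f ^~ x)};
  diffusion_C2 : forall t i j, 0 <= t -> C2 (fun x => a t x i j);
  diffusion_continuous : forall x, {within @halfline R, continuous (a ^~ x)}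
}.

(* `|a t x| is the largest absolute value of an entry, the smallest of the usual
   matrix norms, which makes this condition the least demanding one. *)
Definition coercive_growth f a : Prop :=
  exists2 K : R, 0 < K & forall t x, 0 <= t ->
    2 * (x^T *m f t x) ord0 ord0 + `|a t x| <= K * (1 + enorm x ^+ 2).

Record fokker_planck_solution f a (p : R -> 'cV[R]_N -> R) : Prop := {
  fp_C2 : forall t, 0 <= t -> C2 (p t);
  fp_derivable : forall t x, 0 <= t -> derivable_within (@halfline R) (p ^~ x) t;
  fp_C1_time : forall x, {within @halfline R,
    continuous (derive_within (@halfline R) (p ^~ x))};
  fp_positive : forall t, 0 <= t -> {ae mu, forall x, 0 < p t x};
  fp_equation : forall t x, 0 <= t ->
    derive_within (@halfline R) (p ^~ x) t = forward f a t (p t) x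
}.

End diffusion.

Section exponential_family.
Context (R : realType) (N n : nat).
Local Notation mu := (lebesgue_cV R N).
Implicit Types (c : 'cV[R]_N -> 'cV[R]_n) (theta : 'cV[R]_n)
  (Theta : set 'cV[R]_n).

(* Where the integral is infinite this is ln 0 = 0, and the function exp_density
   below, of infinite mass, is then not a density. *)
Definition log_partition c theta : R :=
  ln (\int[mu]_x expR ((theta^T *m c x) ord0 ord0)).

Definition exp_density c theta (x : 'cV[R]_N) : R :=
  expR ((theta^T *m c x) ord0 ord0 - log_partition c theta).

Definition fisher_info c theta : 'M[R]_n :=
  \matrix_(i, j) dcov (exp_density c theta)
    (fun x => c x i ord0) (fun x => c x j ord0).

Definition parameter_domain c Theta : Prop :=
  [/\ open Theta, convex_set (Theta : set (convex_lmodType 'cV[R]_n))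
    & forall theta, Theta theta -> is_density (exp_density c theta)].

Record exponential_family c Theta : Prop := {
  ef_domain : parameter_domain c Theta;
  ef_maximal : forall Theta', parameter_domain c Theta' ->
    Theta `<=` Theta' -> Theta' = Theta;
  ef_fisher : forall theta, Theta theta -> fisher_info c theta \in unitmx;
  ef_C2 : forall i, C2 (fun x => c x i ord0)
}.

End exponential_family.

Section projection.
Context (R : realType) (N n : nat).
Local Notation mu := (lebesgue_cV R N).
Implicit Types (f : R -> 'cV[R]_N -> 'cV[R]_N) (a : R -> 'cV[R]_N -> 'M[R]_N)
  (c : 'cV[R]_N -> 'cV[R]_n) (Theta : set 'cV[R]_n) (p : R -> 'cV[R]_N -> R).

Definition finite_projection f a c Theta : Prop :=
  forall t theta, 0 <= t -> Theta theta ->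
  let q := exp_density c theta in
  (\int[mu]_x ((forward f a t q x / q x) ^+ 2 * q x)%:E < +oo)%E.

(* forward f a t acts as the dual of backward f a t against c at the density q. *)
Definition dual_at f a t c (q : 'cV[R]_N -> R) : Prop :=
  forall i, let ci x := c x i ord0 in
  [/\ mu.-integrable setT (fun x => (ci x * forward f a t q x)%:E),
      mu.-integrable setT (fun x => (backward f a t ci x * q x)%:E)
    & \int[mu]_x (ci x * forward f a t q x) = dexpect q (backward f a t ci)].

Record duality_convention f a c Theta p : Prop := {
  dual_family : forall t theta, 0 <= t -> Theta theta ->
    dual_at f a t c (exp_density c theta);
  dual_solution : forall t, 0 <= t -> dual_at f a t c (p t);
  mean_finite : forall t i, 0 <= t ->
    mu.-integrable setT (fun x => (c x i ord0 * p t x)%:E);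
  mean_continuous :
    {within @halfline R, continuous (fun t => dexpect_cV (p t) c)};
  mean_derivable : forall t, 0 <= t ->
    derivable_within (@halfline R) (fun s => dexpect_cV (p s) c) t;
  mean_derivative : forall t, 0 <= t ->
    derive_within (@halfline R) (fun s => dexpect_cV (p s) c) t =
      \col_i (\int[mu]_x (c x i ord0 * derive_within (@halfline R) (p ^~ x) t));
  mean_derivative_backward : forall t, 0 <= t ->
    derive_within (@halfline R) (fun s => dexpect_cV (p s) c) t =
      dexpect_cV (p t) (backward_cV f a t c)
}.

(* The derivative at time 0 is the right derivative; [0, T[ need not be the maximal
   interval of existence. *)
Definition projected_solution f a c Theta (theta0 : 'cV[R]_n) (T : \bar R)
    (theta : R -> 'cV[R]_n) : Prop :=
  let D := [set t : R | 0 <= t /\ (t%:E < T)%E] in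
  theta 0 = theta0 /\ forall t, D t ->
  [/\ Theta (theta t), derivable_within D theta t
    & derive_within D theta t = invmx (fisher_info c (theta t)) *m
        dexpect_cV (exp_density c (theta t)) (backward_cV f a t c)].

End projection.

(* Main.v *)
Require Import Defs.
From mathcomp Require Import all_boot all_order all_algebra.
From mathcomp Require Import all_classical all_reals all_analysis.
From mathcomp Require Import measurable_realfun ring lra.

Set Implicit Arguments.
Unset Strict Implicit.
Unset Printing Implicit Defensive.

Import Order.TTheory GRing.Theory Num.Theory.
Import numFieldNormedType.Exports.

Local Open Scope classical_set_scope.
Local Open Scope ring_scope.

(** For an exponential family q_theta = exp (theta . c - psi theta) and any
    density p with finite E_p[c], the divergence D(p || q_theta) is formally, up to a
    term that depends on p only, psi theta - theta . E_p[c].  Hence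
    D(p || q_theta') - D(p || q_theta) is the mean under p of the affine function
    (theta - theta') . c + psi theta' - psi theta of c, and it depends on p
    through E_p[c] alone.  If E_p[c] = E_theta[c], it may be computed with
    q_theta in place of p, and there it is D(q_theta || q_theta') >= 0: matching
    the moments of c minimizes the divergence ([KL_moment_matching]).  As
    D(p || q_theta) may be infinite, the difference is taken under the integral
    sign, after subtracting the integrable p - q_theta, which makes the integrand
    nonnegative ([KL_change_of_reference]).

    So it suffices to show that the curve theta_t keeps the moments matched:
    m_t = E_(theta_t)[c] and eta_t = E_(p_t)[c] coincide.  The Fisher matrix is
    the derivative of theta |-> E_theta[c], so along the projected equation
    m' = g g^-1 E_theta[L c] = E_theta[L c] = - Lambda m, while duality gives
    eta' = E_p[L c] = - Lambda eta.  The two solve the same diagonal linear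
    equation from the same initial value, hence are equal
    ([linear_ode_zero], applied to each component of the difference).

    The derivative of theta |-> E_theta[c] is obtained without passing to a limit
    under the integral sign: q_(theta+h) is q_theta tilted by exp (h . c), and
    the second-order remainder of the exponential is dominated by |h|^2 times a
    multiple of exp (r |c|_1), which is integrable against q_theta for small r
    since Theta is open
    ([tilted_expansion], [exponential_moment], [statistic_mean_expansion]). *)

(** * Elementary bounds on the exponential *)

Section exponential_bounds.
Context (R : realType).
Implicit Types u r : R.

(** From 1 - u <= exp (- u) the remainder lies between 0 and u (exp u - 1), and
    |exp u - 1| <= |u| exp |u|. *)
Lemma expR_remainder2 u : `|expR u - 1 - u| <= u ^+ 2 * expR `|u|.
Proof.
have lo := expR_ge1Dx u.
have hi : (1 - u) * expR u <= 1.
  have := expR_ge1Dx (- u); rewrite -(ler_pM2r (expR_gt0 u)) -expRD addNr expR0.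
  by [].
have e0 := expR_gt0 u.
rewrite ger0_norm; last by lra.
have [u0|u0] := leP 0 u.
  by rewrite ger0_norm//; nra.
rewrite ltr0_norm//.
have : 1 <= expR (- u) by rewrite -expR0 ler_expR; lra.
nra.
Qed.

(** (1 + v / 2) ^ 2 <= exp v for v >= 0, from the tangent inequality at v / 2. *)
Lemma expR_ge_sqr r u : 0 <= r -> 0 <= u -> (r * u) ^+ 2 <= 4 * expR (r * u).
Proof.
move=> r0 u0.
have -> : expR (r * u) = expR (r * u / 2) ^+ 2.
  by rewrite expr2 -expRD -splitr.
have := expR_ge1Dx (r * u / 2); have := mulr_ge0 r0 u0; nra.
Qed.

Lemma expR_ge_id u : u <= expR u.
Proof. by have := expR_ge1Dx u; lra. Qed.

End exponential_bounds.

(** * Integrals of real functions *)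

Section real_integrals.
Context (R : realType) d (T : measurableType d) (mu : {measure set T -> \bar R}).
Implicit Types f g : T -> R.

Lemma integrable_le f g : measurable_fun setT f -> (forall x, `|f x| <= g x) ->
  mu.-integrable setT (EFin \o g) -> mu.-integrable setT (EFin \o f).
Proof.
move=> mf fg ig; apply: le_integrable ig => //; first exact/measurable_EFinP.
by move=> x _ /=; rewrite lee_fin (le_trans (fg x))// ler_norm.
Qed.

Lemma integrable_scale (k : R) f : mu.-integrable setT (EFin \o f) ->
  mu.-integrable setT (EFin \o (fun x => k * f x)).
Proof.
by move=> fi; have := integrableZl measurableT k fi; apply: eq_integrable.
Qed.

Lemma integrable_add f g : mu.-integrable setT (EFin \o f) ->
  mu.-integrable setT (EFin \o g) ->
  mu.-integrable setT (EFin \o (fun x => f x + g x)).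
Proof.
by move=> fi gi; have := integrableD measurableT fi gi; apply: eq_integrable.
Qed.

Lemma integrable_sub f g : mu.-integrable setT (EFin \o f) ->
  mu.-integrable setT (EFin \o g) ->
  mu.-integrable setT (EFin \o (fun x => f x - g x)).
Proof.
by move=> fi gi; have := integrableB measurableT fi gi; apply: eq_integrable.
Qed.

Lemma integrable_bigsum (I : Type) (s : seq I) (F : I -> T -> R) :
  (forall i, mu.-integrable setT (EFin \o F i)) ->
  mu.-integrable setT (EFin \o (fun x => \sum_(i <- s) F i x)).
Proof.
move=> iF; elim: s => [|i s IHs].
  by apply: eq_integrable (integrable0 mu setT) => // x _ /=; rewrite big_nil.
apply: eq_integrable (integrable_add (iF i) IHs) => // x _ /=.
by rewrite big_cons.
Qed.

Lemma Rintegral_bigsum (I : Type) (s : seq I) (F : I -> T -> R) :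
  (forall i, mu.-integrable setT (EFin \o F i)) ->
  \int[mu]_x (\sum_(i <- s) F i x) = \sum_(i <- s) \int[mu]_x F i x.
Proof.
move=> iF; elim: s => [|i s IHs].
  rewrite big_nil -[RHS](Rintegral_set0 mu (fun=> 0)) (Rintegral_mkcond mu set0).
  by apply: eq_Rintegral => x _; rewrite big_nil patch_set0.
rewrite big_cons -IHs -RintegralD//; last exact: integrable_bigsum.
by apply: eq_Rintegral => x _; rewrite big_cons.
Qed.

(** Additivity survives an infinite integral of f because the negative part of
    f + g is at most |g|, so the integral of f + g is never of the form oo - oo. *)
Lemma integral_ge0D_integrable f g : measurable_fun setT f ->
  (forall x, 0 <= f x) -> mu.-integrable setT (EFin \o g) ->
  (\int[mu]_x (f x + g x)%:E = \int[mu]_x (f x)%:E + \int[mu]_x (g x)%:E)%E.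
Proof.
move=> mf f0 ig.
have mg : measurable_fun setT g by apply/measurable_EFinP; exact: measurable_int ig.
have mh : measurable_fun setT (EFin \o (fun x => f x + g x)).
  by apply/measurable_EFinP; exact: measurable_funD.
have [foo|foo] := eqVneq (\int[mu]_x (f x)%:E)%E +oo%E; last first.
  have fi : mu.-integrable setT (EFin \o f).
    apply/integrableP; split; first exact/measurable_EFinP.
    under eq_integral => x _ do rewrite /= ger0_norm//.
    by rewrite ltey.
  by rewrite -(integralD_EFin measurableT fi ig).
have gN : (\int[mu]_x `|(g x)%:E| < +oo)%E by case/integrableP : ig.
have gfin : (\int[mu]_x (g x)%:E)%E \is a fin_num.
  exact: integrable_fin_num.
rewrite foo addye; last by rewrite -ltNye; case/fin_numP : gfin; rewrite ltNye.
set h := EFin \o (fun x => f x + g x).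
rewrite -[LHS]/(\int[mu]_x h x)%E integralE.
have hN : (\int[mu]_x h^\- x < +oo)%E.
  apply: le_lt_trans gN; apply: ge0_le_integral => //.
  - exact: measurable_funeneg.
  - by apply/measurable_EFinP; exact: measurableT_comp.
  - move=> x _; rewrite funenegE /h /= ge_max !lee_fin normr_ge0 andbT.
    by have := f0 x; have := ler_norm (- g x); rewrite normrN; lra.
have hP : (\int[mu]_x h^\+ x = +oo)%E.
  apply/eqP; rewrite -leye_eq leNgt; apply/negP => hlt.
  suff: (\int[mu]_x (f x)%:E < +oo)%E by rewrite foo ltxx.
  apply: (@le_lt_trans _ _ (\int[mu]_x (h^\+ x + `|(g x)%:E|))%E).
    apply: ge0_le_integral => //.
    - by move=> x _; rewrite lee_fin.
    - exact/measurable_EFinP.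
    - apply: emeasurable_funD; first exact: measurable_funepos.
      by apply/measurable_EFinP; exact: measurableT_comp.
    - move=> x _; rewrite funeposE /h /= -EFin_max -EFinD lee_fin.
      have : f x + g x <= Num.max (f x + g x) 0 by rewrite le_max lexx.
      by have := ler_norm (- g x); rewrite normrN; lra.
  rewrite ge0_integralD//.
  - exact: lte_add_pinfty.
  - exact: measurable_funepos.
  - by apply/measurable_EFinP; exact: measurableT_comp.
rewrite hP addye//.
by rewrite eqe_oppLR /= -ltey.
Qed.

End real_integrals.

(** * Calculus with one-sided derivatives *)

Section one_sided_calculus.
Context (R : realType).
Implicit Types (D : set R) (t : R).

Definition quotient (V : normedModType R) (u : R -> V) (t s : R) : V :=
  (s - t)^-1 *: (u s - u t).

(** The same quotient for scalar functions, written with the product of R so that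
    the ring laws apply to it. *)
Definition slope (y : R -> R) (t s : R) : R := (s - t)^-1 * (y s - y t).

Lemma derivable_within_entry n D (u : R -> 'cV[R]_n) t i :
  derivable_within D u t ->
  slope (fun s => u s i ord0) t s @[s --> within D t^'] -->
  derive_within D u t i ord0.
Proof.
move=> du; have := cvg_comp _ _ du (@coord_continuous _ _ _ i ord0 _).
apply: cvg_trans; apply: near_eq_cvg; apply: nearW => s /=.
by rewrite /slope !mxE.
Qed.

Lemma within_dnbhs_neq D t : \forall s \near within D t^', s != t.
Proof. exact: (cvg_within D (nbhs_dnbhs_neq t)). Qed.

Lemma cvg_within_dnbhs D t : s @[s --> within D t^'] --> t.
Proof.
by move=> A At; apply: (cvg_within D); exact: nbhs_dnbhs.
Qed.

Lemma cvg_increment D t : (s - t) @[s --> within D t^'] --> (0 : R).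
Proof.
rewrite -(subrr t).
by apply: cvgB; [exact: cvg_within_dnbhs|exact: cvg_cst].
Qed.

(** A quadratic remainder at h = u s - u t is C |q|^2 |s - t|^2, with q the
    difference quotient of u, so it stays negligible after division by s - t. *)
Lemma chain_rule_within n D (u : R -> 'cV[R]_n) t (v : 'cV[R]_n)
    (F : 'cV[R]_n -> R) (l : 'I_n -> R) (r C : R) :
  0 < r ->
  (forall h, `|h| <= r ->
    `|F (u t + h) - F (u t) - \sum_j h j ord0 * l j| <= C * `|h| ^+ 2) ->
  quotient u t s @[s --> within D t^'] --> v ->
  slope (F \o u) t s @[s --> within D t^'] -->
    \sum_j v j ord0 * l j.
Proof.
move=> r0 FE uv; set G := within D t^'.
have GF : Filter G by exact: within_filter.
pose E s := slope (F \o u) t s - \sum_j quotient u t s j ord0 * l j.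
have st : (s - t) @[s --> G] --> (0 : R) by exact: cvg_increment.
have nst : `|s - t| @[s --> G] --> (0 : R).
  by rewrite -(@normr0 _ R); exact: cvg_norm st.
have nq : `|quotient u t s| @[s --> G] --> `|v| by exact: cvg_norm uv.
have Esum : \sum_j quotient u t s j ord0 * l j @[s --> G] -->
    \sum_j v j ord0 * l j.
  apply: cvg_big => [|j _]; first exact: add_continuous.
  apply: cvgM; last exact: cvg_cst.
  exact: cvg_comp uv (@coord_continuous _ _ _ j ord0 _).
have incr s : s != t -> u s = u t + (s - t) *: quotient u t s.
  by move=> s_t; rewrite scalerA divff ?subr_eq0// scale1r addrC subrK.
have E0 : E s @[s --> G] --> (0 : R).
  apply/norm_cvg0P.
  have B0 : C * `|quotient u t s| ^+ 2 * `|s - t| @[s --> G] --> (0 : R).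
    rewrite -(mulr0 (C * `|v| ^+ 2)); apply: cvgM => //.
    by apply: cvgM; [exact: cvg_cst|rewrite !expr2; exact: cvgM].
  apply: (squeeze_cvgr _ (cvg_cst 0) B0).
  have small : \forall s \near G, `|s - t| * `|quotient u t s| <= r.
    have : (`|s - t| * `|quotient u t s|) @[s --> G] --> (0 : R).
      by rewrite -(mul0r `|v|); exact: cvgM.
    by move/cvgr_le; exact.
  near=> s; rewrite normr_ge0 /=.
  have s_t : s != t by near: s; exact: within_dnbhs_neq.
  have dst : 0 < `|s - t| by rewrite normr_gt0 subr_eq0.
  set h := (s - t) *: quotient u t s.
  have hE : `|h| = `|s - t| * `|quotient u t s| by rewrite normrZ.
  have hr : `|h| <= r by rewrite hE; near: s.
  have -> : E s = (s - t)^-1 *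
      (F (u t + h) - F (u t) - \sum_j h j ord0 * l j).
    rewrite /E /slope /= incr// -/h [RHS]mulrBr; congr (_ - _).
    rewrite mulr_sumr; apply: eq_bigr => j _.
    by rewrite /h [in RHS]mxE !mulrA mulVf ?mul1r// subr_eq0.
  rewrite normrM normfV ler_pdivrMl// (le_trans (FE _ hr))// hE.
  rewrite exprMn (_ : C * _ = `|s - t| * (C * `|quotient u t s| ^+ 2 * `|s - t|))//.
  by ring.
have ES : E s + \sum_j quotient u t s j ord0 * l j @[s --> G] -->
    \sum_j v j ord0 * l j.
  by rewrite -[X in _ --> X]add0r; exact: cvgD.
apply: cvg_trans ES; apply: near_eq_cvg; by apply: nearW => s; rewrite /E subrK.
Unshelve. all: by end_near. Qed.

Lemma slope_is_derive (y : R -> R) t (l : R) :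
  slope y t s @[s --> t^'] --> l -> is_derive t 1 y l.
Proof.
move=> ql.
have sh : (h + t) @[h --> (0 : R)^'] --> t^'.
  move=> A /nbhs_ballP[e /= e0 eA]; apply/nbhs_ballP; exists e => //= h.
  rewrite -ball_normE /= sub0r normrN => he h0; apply: eA.
    by rewrite -ball_normE /= opprD addrCA subrr addr0 normrN.
  by apply: contra_neq h0 => ht; apply: (addIr t); rewrite add0r.
have dl : h^-1 *: ((y \o shift t) (h *: (1 : R^o)) - y t) @[h --> (0 : R)^'] --> l.
  have := cvg_comp _ _ sh ql; apply: cvg_trans; apply: near_eq_cvg.
  by apply: nearW => h /=; rewrite /slope /= addrK /GRing.scale /= mulr1.
apply: DeriveDef; first by apply/cvg_ex; exists l.
exact: (cvg_lim _ dl).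
Qed.

Lemma slope_continuous D (y : R -> R) t (l : R) :
  slope y t s @[s --> within D t^'] --> l ->
  y s @[s --> within D t^'] --> y t.
Proof.
move=> ql; set G := within D t^'.
have GF : Filter G by exact: within_filter.
have : (y t + (s - t) * slope y t s) @[s --> G] --> y t + 0 * l.
  have sl : ((s - t) * slope y t s) @[s --> G] --> 0 * l.
    by apply: cvgM; [exact: cvg_increment|exact: ql].
  by apply: cvgD; [exact: cvg_cst|exact: sl].
rewrite mul0r addr0; apply: cvg_trans; apply: near_eq_cvg.
near=> s.
have s_t : s - t != 0 by rewrite subr_eq0; near: s; exact: within_dnbhs_neq.
by rewrite /slope mulrA divff// mul1r addrC subrK.
Unshelve. all: by end_near. Qed.

(** exp (- k t) y t has derivative 0 in the interior and is continuous up to the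
    end points, hence keeps its initial value 0. *)
Lemma linear_ode_zero (T : \bar R) (y : R -> R) (k : R) :
  let D := [set t : R | 0 <= t /\ (t%:E < T)%E] in
  (forall t, D t ->
    slope y t s @[s --> within D t^'] --> k * y t) ->
  y 0 = 0 -> forall t, D t -> y t = 0.
Proof.
move=> D dy y0 t [t0 tT].
have [->//|tneq] := eqVneq t 0.
have {tneq} {}t0 : 0 < t by rewrite lt_neqAle eq_sym tneq.
have Dx x : 0 <= x -> x <= t -> D x.
  by move=> x0 xt; split => //; apply: le_lt_trans tT; rewrite lee_fin.
(* Since t < T, only the time 0 of [0, t] fails to be interior to D. *)
have Dnbhs x : 0 < x -> x <= t -> nbhs x D.
  move=> x0 xt.
  have Tx : \forall s \near x, (s%:E < T)%E.
    have [_] := Dx x (ltW x0) xt; case: (T) => [T'| |] //.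
      rewrite lte_fin => /lt_nbhsl xT; near=> s.
      by rewrite lte_fin; near: s.
    by move=> _; near=> s; rewrite ltry.
  have Px : \forall s \near x, 0 < s.
    exact: open_nbhs_nbhs (conj (@open_gt _ (0 : R)) x0).
  apply: (@filterS2 _ (nbhs x) _ _ _ _ _ Px Tx).
  by move=> s /= s0 sT; split => //; exact: ltW.
have dnb x : 0 < x -> x <= t -> slope y x s @[s --> x^'] --> k * y x.
  move=> x0 xt A /(dy x (Dx x (ltW x0) xt)) wA.
  have xD : x^' D := nbhs_dnbhs (Dnbhs x x0 xt).
  apply: (@filterS2 _ x^' _ _ _ _ _ xD wA).
  by move=> s Ds /(_ Ds).
pose z s := expR (- k * s) * y s.
have dz x : x \in `]0, t[ -> is_derive x 1 z 0.
  rewrite in_itv /= => /andP[x0 xt].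
  have dyx := slope_is_derive (dnb x x0 (ltW xt)).
  have dk : is_derive x 1 (fun s : R => - k * s) (- k).
    have := is_deriveZ (- k) (is_derive_id x (1 : R)).
    by rewrite /GRing.scale /= mulr1.
  have de := is_derive1_comp (is_derive_expR (- k * x)) dk.
  apply: (is_derive_eq (is_deriveM de dyx)).
  by rewrite /GRing.scale /=; ring.
have cexp : continuous (fun s : R => expR (- k * s)).
  move=> s; apply: continuous_comp; last exact: continuous_expR.
  by apply: cvgM; [exact: cvg_cst|exact: cvg_id].
have cz : {within `[0, t], continuous z}.
  apply/(continuous_within_itvP _ t0); split.
  - move=> x; rewrite in_itv /= => /andP[x0 xt].
    apply/differentiable_continuous/derivable1_diffP.
    by case: (dz x); rewrite ?in_itv /= ?x0.
  - apply: cvgM.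
      exact/cvg_at_right_filter/cexp.
    have D0 : D 0 by exact: Dx (ltW t0).
    move=> A /(slope_continuous (dy 0 D0)) yA.
    have [e /= e0 eA] := yA; exists (Num.min e t) => /=.
      by rewrite lt_min e0 t0.
    move=> s /=; rewrite sub0r normrN lt_min => /andP[se st] s0.
    apply: eA => //=; first by rewrite sub0r normrN.
      by rewrite gt_eqF.
    by apply: Dx; [exact: ltW|exact: ltW (le_lt_trans (ler_norm _) st)].
  - apply: cvgM.
      exact/cvg_at_left_filter/cexp.
    apply: cvg_dnbhs_at_left; rewrite -(@withinET _ t^').
    by apply: slope_continuous; rewrite withinET; exact: dnb.
have [x _] := MVT t0 dz cz.
rewrite mul0r /z y0 mulr0 subr0 => /eqP.
by rewrite mulf_eq0 gt_eqF ?expR_gt0//= => /eqP.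
Unshelve. all: by end_near. Qed.

End one_sided_calculus.

(** * Pairing of parameters with statistics *)

Section dot_product.
Context (R : realType) (n : nat).
Implicit Types h v : 'cV[R]_n.

Definition dot h v : R := (h^T *m v) ord0 ord0.

Definition l1norm v : R := \sum_i `|v i ord0|.

Lemma dotE h v : dot h v = \sum_i h i ord0 * v i ord0.
Proof. by rewrite /dot mxE; apply: eq_bigr => i _; rewrite mxE. Qed.

Lemma dotDl h h' v : dot (h + h') v = dot h v + dot h' v.
Proof. by rewrite /dot linearD mulmxDl mxE. Qed.

Lemma dotBl h h' v : dot (h - h') v = dot h v - dot h' v.
Proof. by rewrite /dot linearB mulmxBl !mxE. Qed.

Lemma dotZl a h v : dot (a *: h) v = a * dot h v.
Proof. by rewrite /dot linearZ -scalemxAl mxE. Qed.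

Lemma dot_delta i v : dot (delta_mx i ord0) v = v i ord0.
Proof.
rewrite dotE (bigD1 i)//= mxE !eqxx mul1r big1 ?addr0// => j ji.
by rewrite mxE (negbTE ji) mul0r.
Qed.

Lemma l1norm_ge0 v : 0 <= l1norm v.
Proof. by apply: sumr_ge0 => i _; exact: normr_ge0. Qed.

Lemma entry_le_l1norm v i : `|v i ord0| <= l1norm v.
Proof. by rewrite /l1norm (bigD1 i)//= lerDl sumr_ge0. Qed.

Lemma entry_le_norm v i : `|v i ord0| <= `|v|.
Proof.
rewrite [leRHS]/Num.norm /= mx_normrE.
exact: (le_bigmax _ (fun ij : 'I_n * 'I_1 => `|v ij.1 ij.2|) (i, ord0)).
Qed.

Lemma norm_le_entries v (e : R) : 0 <= e -> (forall i, `|v i ord0| <= e) ->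
  `|v| <= e.
Proof.
move=> e0 ve; rewrite [leLHS]/Num.norm /= mx_normrE; apply: bigmax_le => //.
by move=> -[i j] _ /=; rewrite ord1.
Qed.

(** The norm of matrices is the largest absolute value of an entry, which is dual
    to the sum of absolute values. *)
Lemma norm_dot_le h v : `|dot h v| <= `|h| * l1norm v.
Proof.
rewrite dotE (le_trans (ler_norm_sum _ _ _))// /l1norm mulr_sumr.
by apply: ler_sum => i _; rewrite normrM ler_wpM2r ?entry_le_norm.
Qed.

End dot_product.

(** * Second-order expansion of exponentially tilted integrals *)

Section tilted_integrals.
Context (R : realType) d (T : measurableType d) (mu : {measure set T -> \bar R}).
Context (n : nat) (u : T -> 'cV[R]_n) (w : T -> R) (r : R).
Hypothesis measurable_u : forall i, measurable_fun setT (fun x => u x i ord0).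
Hypothesis mw : measurable_fun setT w.
Hypothesis w_ge0 : forall x, 0 <= w x.
Hypothesis r_gt0 : 0 < r.
(* One factor exp (r |u|_1) pays for phi, one for the tilt, and one for the
   polynomial that multiplies them. *)
Hypothesis exp_moment :
  mu.-integrable setT (EFin \o (fun x => expR (3 * r * l1norm (u x)) * w x)).

Lemma measurable_dot h : measurable_fun setT (fun x => dot h (u x)).
Proof.
rewrite (eq_fun (fun x => dotE h (u x))).
by apply: measurable_sum => i; apply: measurable_funM.
Qed.

Context (phi : T -> R) (K : R).
Hypothesis mphi : measurable_fun setT phi.
Hypothesis phi_le : forall x, `|phi x| <= K * expR (r * l1norm (u x)).

Let l1 x := l1norm (u x).

Let K_ge0 (x : T) : 0 <= K.
Proof.
have := le_trans (normr_ge0 _) (phi_le x).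
by rewrite pmulr_lge0// expR_gt0.
Qed.

Let integrable_dominated (g : T -> R) (k : R) : measurable_fun setT g ->
  (forall x, `|g x| <= k * expR (2 * r * l1 x)) ->
  mu.-integrable setT (EFin \o (fun x => phi x * g x * w x)).
Proof.
move=> mg gk.
apply: (@integrable_le _ _ _ _ _
  (fun x => (K * k) * (expR (3 * r * l1 x) * w x))).
- by apply: measurable_funM => //; exact: measurable_funM.
- move=> x; rewrite !normrM (ger0_norm (w_ge0 x)) mulrA ler_wpM2r//.
  rewrite (_ : 3 * r * l1 x = r * l1 x + 2 * r * l1 x); last by ring.
  by rewrite expRD mulrACA ler_pM// phi_le.
- exact: integrable_scale.
Qed.

Let l1_ge0 x : 0 <= l1 x := l1norm_ge0 (u x).

Lemma integrable_tilted_base :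
  mu.-integrable setT (EFin \o (fun x => phi x * w x)).
Proof.
suff /(@integrable_dominated (cst 1) 1 (measurable_cst _)) :
    forall x, `|cst 1 x : R| <= 1 * expR (2 * r * l1 x).
  by apply: eq_integrable => // x _ /=; rewrite mulr1.
move=> x; rewrite /= normr1 mul1r -[leLHS]expR0 ler_expR.
by rewrite !mulr_ge0// ltW.
Qed.

Lemma integrable_tilted_entry j :
  mu.-integrable setT (EFin \o (fun x => phi x * u x j ord0 * w x)).
Proof.
apply: (@integrable_dominated _ (2 * r)^-1) => // x.
rewrite ler_pdivlMl ?mulr_gt0//.
apply: (le_trans _ (expR_ge_id _)).
by rewrite ler_wpM2l ?entry_le_l1norm// mulr_ge0// ltW.
Qed.

Let expR_dot_le (h : 'cV[R]_n) x : `|h| <= r -> expR `|dot h (u x)| <= expR (r * l1 x).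
Proof.
move=> hr; rewrite ler_expR (le_trans (norm_dot_le _ _))//.
by rewrite ler_wpM2r // l1norm_ge0.
Qed.

Lemma integrable_tilted (h : 'cV[R]_n) : `|h| <= r ->
  mu.-integrable setT (EFin \o (fun x => phi x * expR (dot h (u x)) * w x)).
Proof.
move=> hr; apply: (@integrable_dominated _ 1) => [|x].
  by apply: measurableT_comp => //; exact: measurable_dot.
rewrite mul1r ger0_norm ?expR_ge0//.
apply: (@le_trans _ _ (expR (r * l1 x))).
  apply: le_trans (expR_dot_le x hr); rewrite ler_expR; exact: ler_norm.
by rewrite ler_expR -mulrA ler_peMl// ?mulr_ge0// ?ltW//; lra.
Qed.

(** With v = h . u, the remainder is the integral of phi (exp v - 1 - v) w;
    pointwise |v| <= |h| |u|_1, so |exp v - 1 - v| <= |h|^2 |u|_1^2 exp (r |u|_1),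
    and |u|_1^2 <= 4 r^-2 exp (r |u|_1). *)
Lemma tilted_expansion : exists2 C : R, 0 <= C &
  forall h : 'cV[R]_n, `|h| <= r ->
  `|\int[mu]_x (phi x * expR (dot h (u x)) * w x) - \int[mu]_x (phi x * w x)
     - \sum_j h j ord0 * \int[mu]_x (phi x * u x j ord0 * w x)|
  <= C * `|h| ^+ 2.
Proof.
pose G x := K * (4 / r ^+ 2) * (expR (3 * r * l1 x) * w x).
have iG : mu.-integrable setT (EFin \o G) by exact: integrable_scale.
have G0 x : 0 <= G x.
  by rewrite !mulr_ge0 ?expR_ge0// ?(K_ge0 x)// invr_ge0 exprn_ge0// ltW.
exists (\int[mu]_x G x); first exact: Rintegral_ge0.
move=> h hr.
have i1 := integrable_tilted hr.
have i0 := integrable_tilted_base.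
have iu j := integrable_scale (h j ord0) (integrable_tilted_entry j).
have isum := integrable_bigsum (index_enum 'I_n) iu.
have i10 := integrable_sub i1 i0.
have -> : \sum_j h j ord0 * \int[mu]_x (phi x * u x j ord0 * w x) =
    \int[mu]_x \sum_j h j ord0 * (phi x * u x j ord0 * w x).
  rewrite Rintegral_bigsum//; apply: eq_bigr => j _.
  by rewrite RintegralZl//; exact: integrable_tilted_entry.
rewrite -RintegralB// -RintegralB//.
have ii := integrable_sub i10 isum.
rewrite (le_trans (le_normr_Rintegral _ ii))//.
rewrite -RintegralZr//; apply: le_Rintegral => //.
- exact: integrable_norm.
- by have := integrable_scale (`|h| ^+ 2) iG;
    apply: eq_integrable => // x _ /=; rewrite mulrC.
move=> x _.
have -> : \sum_j h j ord0 * (phi x * u x j ord0 * w x) =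
    phi x * dot h (u x) * w x.
  by rewrite dotE mulr_sumr mulr_suml; apply: eq_bigr => j _; ring.
rewrite -!mulrBl -{2}(mulr1 (phi x)) -!mulrBr !normrM (ger0_norm (w_ge0 x)).
set E := expR (r * l1 x).
have -> : G x * `|h| ^+ 2 = K * E * (`|h| ^+ 2 * (4 * E / r ^+ 2) * E) * w x.
  rewrite /G (_ : 3 * r * l1 x = r * l1 x + r * l1 x + r * l1 x); last by ring.
  by rewrite !expRD -/E; ring.
rewrite ler_wpM2r//.
rewrite ler_pM ?phi_le//.
rewrite (le_trans (expR_remainder2 _))// ler_pM ?sqr_ge0 ?expR_ge0//; last first.
  exact: expR_dot_le.
rewrite -real_normK ?num_real//.
have := norm_dot_le h (u x) => hd.
apply: (@le_trans _ _ ((`|h| * l1 x) ^+ 2)).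
  by rewrite ler_sqr ?nnegrE// mulr_ge0.
rewrite exprMn ler_wpM2l ?sqr_ge0// ler_pdivlMr ?exprn_gt0// mulrC -exprMn.
by apply: expR_ge_sqr => //; rewrite ltW.
Qed.

End tilted_integrals.

(** * Densities and relative entropy *)

Section densities.
Context (R : realType) (N n : nat).
Local Notation mu := (lebesgue_cV R N).
Implicit Types (p q : 'cV[R]_N -> R) (h : 'cV[R]_n).

Lemma integrable_density p : is_density p -> mu.-integrable setT (EFin \o p).
Proof.
move=> [mp p0 p1]; apply/integrableP; split; first exact/measurable_EFinP.
by under eq_integral => x _ do rewrite /= ger0_norm//; rewrite p1 ltry.
Qed.

Lemma Rintegral_density p : is_density p -> \int[mu]_x p x = 1.
Proof. by move=> [_ _ p1]; rewrite /Rintegral p1. Qed.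

Lemma dexpect_subr p (f : 'cV[R]_N -> R) (m : R) : is_density p ->
  mu.-integrable setT (EFin \o (fun x => f x * p x)) ->
  dexpect p (fun x => f x - m) = dexpect p f - m.
Proof.
move=> dp fi; have ip := integrable_density dp.
rewrite /dexpect (eq_Rintegral _ (fun x _ => mulrBl _ _ _)) RintegralB//.
  by rewrite (RintegralZl _ measurableT ip) (Rintegral_density dp) mulr1.
exact: integrable_scale.
Qed.

Lemma dexpect_affine p (u : 'cV[R]_N -> 'cV[R]_n) h (b : R)
    (l : 'cV[R]_N -> R) : is_density p ->
  (forall i, mu.-integrable setT (EFin \o (fun x => u x i ord0 * p x))) ->
  (forall x, l x = dot h (u x) + b) ->
  mu.-integrable setT (EFin \o (fun x => l x * p x)) /\
  dexpect p l = \sum_i h i ord0 * dexpect p (fun x => u x i ord0) + b.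
Proof.
move=> dp iu lE.
have iZ i := integrable_scale (h i ord0) (iu i).
have isum := integrable_bigsum (index_enum 'I_n) iZ.
have ib := integrable_scale b (integrable_density dp).
have E x : l x * p x = \sum_i h i ord0 * (u x i ord0 * p x) + b * p x.
  rewrite lE mulrDl dotE mulr_suml; congr (_ + _).
  by apply: eq_bigr => i _; rewrite mulrA.
split.
  by apply: eq_integrable (integrable_add isum ib) => // x _ /=; rewrite E.
rewrite /dexpect (eq_Rintegral _ (fun x _ => E x)) RintegralD// Rintegral_bigsum//.
rewrite (RintegralZl _ measurableT (integrable_density dp)).
rewrite (Rintegral_density dp) mulr1.
by congr (_ + _); apply: eq_bigr => i _; rewrite RintegralZl.
Qed.

(** The inequality ln v <= v - 1 at v = b / a; at a = 0 the left-hand side is - b. *)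
Lemma mul_ln_ratio_ge (a b : R) : 0 <= a -> 0 < b -> a - b <= a * ln (a / b).
Proof.
rewrite le_eqVlt => /predU1P[<-|a0] b0; first by rewrite mul0r; lra.
have := expR_ge1Dx (- ln (a / b)).
rewrite expRN lnK ?posrE ?divr_gt0// invf_div => h.
have : a * (1 - ln (a / b)) <= a * (b / a) by rewrite ler_pM2l.
by rewrite [X in _ <= X]mulrC divfK ?gt_eqF//; lra.
Qed.

(** Pointwise p ln (p / q') = p ln (p / q) + p (ln q - ln q').  The function
    F = p ln (p / q) - (p - q) is nonnegative and p - q has integral 0, so both
    divergences are the integral of F plus that of an integrable function, also
    when F has infinite integral. *)
Lemma KL_change_of_reference p q q' : is_density p -> is_density q ->
  is_density q' -> (forall x, 0 < q x) -> (forall x, 0 < q' x) ->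
  mu.-integrable setT (EFin \o (fun x => (ln (q x) - ln (q' x)) * p x)) ->
  KL p q' = (KL p q + (dexpect p (fun x => ln (q x) - ln (q' x)))%:E)%E.
Proof.
move=> dp dq dq' q0 q'0 il.
have [mp p0 p1] := dp; have [mq _ q1] := dq.
have ip := integrable_density dp; have iq := integrable_density dq.
pose F x := p x * ln (p x / q x) - (p x - q x).
have F0 x : 0 <= F x by rewrite subr_ge0 mul_ln_ratio_ge.
have mF : measurable_fun setT F.
  apply: measurable_funB; last exact: measurable_funB.
  apply: measurable_funM => //; apply: measurableT_comp; first exact: measurable_ln.
  apply: measurable_funM => //.
  (* Inversion is measurable as the composite of exp, - and ln. *)
  rewrite (_ : (fun x => (q x)^-1) = fun x => expR (- ln (q x))); last first.
    by apply/funext => x; rewrite expRN lnK ?posrE.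
  apply: measurableT_comp => //; apply: measurableT_comp => //.
  by apply: measurableT_comp => //; exact: measurable_ln.
have ipq := integrable_sub ip iq.
have pq0 : (\int[mu]_x (p x - q x)%:E = 0)%E.
  under eq_integral do rewrite EFinB.
  by rewrite integralB//= p1 q1 subee.
have KLq : KL p q = (\int[mu]_x (F x)%:E)%E.
  rewrite -[RHS]adde0 -pq0 -integral_ge0D_integrable//.
  by apply: eq_integral => x _; rewrite /F subrK.
have ipql := integrable_add ipq il.
rewrite KLq.
have -> : KL p q' = (\int[mu]_x (F x + (p x - q x + (ln (q x) - ln (q' x)) * p x))%:E)%E.
  apply: eq_integral => x _; congr (_%:E); rewrite /F addrA subrK.
  (* Where p vanishes, the convention 0 ln 0 = 0 holds by absorption. *)
  have [->|px] := eqVneq (p x) 0; first by rewrite mulr0 !mul0r addr0.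
  have {}px : 0 < p x by rewrite lt_neqAle eq_sym px p0.
  by rewrite !ln_div ?posrE//; ring.
rewrite integral_ge0D_integrable//; congr (_ + _)%E.
under eq_integral do rewrite EFinD.
rewrite integralD//= pq0 add0e /dexpect /Rintegral fineK//.
exact: integrable_fin_num.
Qed.

(** Gibbs' inequality: q ln (q / q') >= q - q', and the right-hand side has
    integral 0. *)
Lemma dexpect_ln_ratio_ge0 q q' : is_density q -> is_density q' ->
  (forall x, 0 < q x) -> (forall x, 0 < q' x) ->
  mu.-integrable setT (EFin \o (fun x => (ln (q x) - ln (q' x)) * q x)) ->
  0 <= dexpect q (fun x => ln (q x) - ln (q' x)).
Proof.
move=> dq dq' q0 q'0 il.
have iq := integrable_density dq; have iq' := integrable_density dq'.
have -> : 0 = \int[mu]_x (q x - q' x).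
  by rewrite RintegralB// !Rintegral_density// subrr.
apply: le_Rintegral => //; first exact: integrable_sub.
move=> x _; have := mul_ln_ratio_ge (ltW (q0 x)) (q'0 x).
by rewrite ln_div ?posrE// mulrC.
Qed.

End densities.

(** * Exponential families *)

Section exponential_family_calculus.
Context (R : realType) (N n : nat).
Local Notation mu := (lebesgue_cV R N).
Implicit Types (p : 'cV[R]_N -> R) (theta h : 'cV[R]_n).
Context (c : 'cV[R]_N -> 'cV[R]_n) (Theta : set 'cV[R]_n).
Context (q : 'cV[R]_n -> 'cV[R]_N -> R) (psi : 'cV[R]_n -> R).
(* On Theta, psi is forced to be the logarithm of the integral of exp (theta . c),
   since q theta has mass 1. *)
Hypothesis qE : forall theta x, q theta x = expR (dot theta (c x) - psi theta).
Hypothesis openTheta : open Theta.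
Hypothesis density_family : forall theta, Theta theta -> is_density (q theta).

Lemma q_gt0 theta x : 0 < q theta x.
Proof. by rewrite qE expR_gt0. Qed.

Lemma q_ge0 theta x : 0 <= q theta x.
Proof. exact: ltW (q_gt0 _ _). Qed.

Lemma ln_q theta x : ln (q theta x) = dot theta (c x) - psi theta.
Proof. by rewrite qE expRK. Qed.

Lemma q_shift theta h x :
  q (theta + h) x = (expR (psi (theta + h) - psi theta))^-1 *
    (expR (dot h (c x)) * q theta x).
Proof. by rewrite !qE dotDl -expRN -!expRD; congr (expR _); ring. Qed.

Lemma family_neighborhood theta : Theta theta ->
  exists2 r : R, 0 < r & forall h, `|h| <= r -> Theta (theta + h).
Proof.
move=> /openTheta /nbhs_ballP[e /= e0 eT].
exists (e / 2) => [|h hr]; first by rewrite divr_gt0.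
apply: eT; rewrite -ball_normE /= opprD addrA subrr add0r normrN.
by rewrite (le_lt_trans hr)//; lra.
Qed.

(** Each c i is, up to a constant and a factor, the difference of the logarithms
    of two members of the family, which are measurable as densities. *)
Lemma measurable_statistic theta : Theta theta ->
  forall i, measurable_fun setT (fun x => c x i ord0).
Proof.
move=> th i; have [r r0 rT] := family_neighborhood th.
pose h : 'cV[R]_n := r *: delta_mx i ord0.
have hr : `|h| <= r.
  rewrite normrZ (gtr0_norm r0) ler_piMr ?(ltW r0)//.
  apply: norm_le_entries => // j.
  by rewrite mxE; case: (_ && _); rewrite ?normr1 ?normr0.
have [m1 _ _] := density_family (rT h hr).
have [m0 _ _] := density_family th.
have mln (f : 'cV[R]_N -> R) : measurable_fun setT f ->
    measurable_fun setT (fun x => ln (f x)).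
  by move=> mf; apply: measurableT_comp => //; exact: measurable_ln.
have -> : (fun x => c x i ord0) = fun x =>
    r^-1 * (ln (q (theta + h) x) - ln (q theta x)
            + (psi (theta + h) - psi theta)).
  apply/funext => x; rewrite !ln_q dotDl dotZl dot_delta.
  by field; rewrite gt_eqF.
apply: measurable_funM => //; apply: measurable_funD => //.
by apply: measurable_funB; exact: mln.
Qed.

(** r |c|_1 is the largest of the s . c over the vectors s with entries r or - r,
    so exp (r |c|_1) q_theta is at most the sum over these s of the functions
    exp (s . c) q_theta, which are multiples of the densities q_(theta+s). *)
Lemma exponential_moment theta : Theta theta -> exists2 r : R, 0 < r &
  (forall h, `|h| <= r -> Theta (theta + h)) /\
  mu.-integrable setT (EFin \o (fun x => expR (r * l1norm (c x)) * q theta x)).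
Proof.
move=> th; have [r r0 rT] := family_neighborhood th.
exists r => //; split => //.
have mc := measurable_statistic th.
pose sgv (s : {ffun 'I_n -> bool}) : 'cV[R]_n := \col_i (if s i then r else - r).
have sgvr s : `|sgv s| <= r.
  apply: norm_le_entries => [|i]; first exact: ltW.
  by rewrite mxE; case: (s i); rewrite ?normrN gtr0_norm.
pose F s x := expR (psi (theta + sgv s) - psi theta) * q (theta + sgv s) x.
have FE s x : F s x = expR (dot (sgv s) (c x)) * q theta x.
  by rewrite /F q_shift mulVKf// gt_eqF// expR_gt0.
have iF s : mu.-integrable setT (EFin \o F s).
  by apply: integrable_scale; exact/integrable_density/density_family/rT.
apply: integrable_le (integrable_bigsum (index_enum _) iF).
  apply: measurable_funM.
    apply: measurableT_comp => //; apply: measurable_funM => //.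
    by apply: measurable_sum => i; exact: measurableT_comp.
  by case: (density_family th).
move=> x; rewrite ger0_norm ?mulr_ge0 ?expR_ge0 ?q_ge0//.
pose s0 : {ffun 'I_n -> bool} := [ffun i => 0 <= c x i ord0].
rewrite (bigD1 s0)//= -[leLHS]addr0 lerD//; last first.
  by apply: sumr_ge0 => s _; rewrite mulr_ge0 ?expR_ge0 ?q_ge0.
rewrite FE ler_wpM2r ?q_ge0// ler_expR dotE /l1norm mulr_sumr.
apply: ler_sum => i _; rewrite mxE ffunE.
case: ifPn => ci; first by rewrite ger0_norm.
by rewrite ltr0_norm ?ltNge// mulrN mulNr.
Qed.

Lemma integrable_statistic theta i : Theta theta ->
  mu.-integrable setT (EFin \o (fun x => c x i ord0 * q theta x)).
Proof.
move=> th; have [r r0 [_ ir]] := exponential_moment th.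
apply: (@integrable_le _ _ _ _ _
  (fun x => r^-1 * (expR (r * l1norm (c x)) * q theta x))).
- apply: measurable_funM; first exact: measurable_statistic th i.
  by case: (density_family th).
- move=> x; rewrite normrM (gtr0_norm (q_gt0 _ _)) mulrA.
  rewrite ler_wpM2r ?q_ge0// ler_pdivlMl//.
  apply: (le_trans _ (expR_ge_id _)).
  by rewrite ler_wpM2l ?entry_le_l1norm ?(ltW r0).
- exact: integrable_scale.
Qed.

Definition statistic_mean theta i : R := dexpect (q theta) (fun x => c x i ord0).

Definition statistic_cov theta i j : R :=
  dcov (q theta) (fun x => c x i ord0) (fun x => c x j ord0).

(** With phi = c i - E_theta[c i] and B = exp (psi (theta + h) - psi theta), the
    difference of means is E_theta[phi exp (h . c)] / B, since
    q_(theta+h) = exp (h . c) q_theta / B.  The numerator expands to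
    sum_j h j Cov(c i, c j) + O(|h|^2), because E_theta[phi] = 0; taking phi = 1
    instead shows B = 1 + O(|h|), so that dividing by B changes only the
    remainder. *)
Lemma statistic_mean_expansion theta i : Theta theta ->
  exists r C : R, [/\ 0 < r, 0 <= C & forall h, `|h| <= r ->
    `|statistic_mean (theta + h) i - statistic_mean theta i
       - \sum_j h j ord0 * statistic_cov theta i j| <= C * `|h| ^+ 2].
Proof.
move=> th; have [r3 r30 [rT3 ir3]] := exponential_moment th.
(* The expansion of tilted integrals spends the exponential moment three times. *)
pose r := r3 / 3.
have r0 : 0 < r by rewrite divr_gt0.
have rT h : `|h| <= r -> Theta (theta + h).
  by move=> hr; apply: rT3; rewrite (le_trans hr)// /r; lra.
have ir : mu.-integrable setT
    (EFin \o (fun x => expR (3 * r * l1norm (c x)) * q theta x)).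
  by rewrite (_ : 3 * r = r3)// /r; field.
have mc := measurable_statistic th.
have [mq q0 _] := density_family th.
pose m := statistic_mean theta i.
pose phi x := c x i ord0 - m.
have mphi : measurable_fun setT phi by exact: measurable_funB.
have e1 x : 1 <= expR (r * l1norm (c x)).
  by rewrite -expR0 ler_expR mulr_ge0 ?l1norm_ge0// ltW.
have phi_le x : `|phi x| <= (r^-1 + `|m|) * expR (r * l1norm (c x)).
  rewrite (le_trans (ler_normB _ _))// mulrDl lerD//.
    rewrite ler_pdivlMl//; apply: (le_trans _ (expR_ge_id _)).
    by rewrite ler_wpM2l ?entry_le_l1norm ?(ltW r0).
  by rewrite ler_peMr.
have one_le x : `|cst 1 x : R| <= 1 * expR (r * l1norm (c x)).
  by rewrite /= normr1 mul1r.
have mone : measurable_fun [set: 'cV[R]_N] (cst 1 : _ -> R).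
  exact: measurable_cst.
have [C1 C10 B1] := tilted_expansion mc mq q0 r0 ir mone one_le.
have [C2 C20 B2] := tilted_expansion mc mq q0 r0 ir mphi phi_le.
have iphi := integrable_tilted_base mq q0 r0 ir mphi phi_le.
have iphic := integrable_tilted_entry mc mq q0 r0 ir mphi phi_le.
have phi0 : \int[mu]_x (phi x * q theta x) = 0.
  rewrite -/(dexpect _ _) dexpect_subr ?subrr//; first exact: density_family.
  exact: integrable_statistic.
have phic j : \int[mu]_x (phi x * c x j ord0 * q theta x) =
    statistic_cov theta i j.
  rewrite /statistic_cov /dcov -/(statistic_mean theta i) -/(statistic_mean theta j) -/m.
  move: (statistic_mean theta j) => mj; rewrite /dexpect.
  have E x : (c x i ord0 - m) * (c x j ord0 - mj) * q theta x =
      phi x * c x j ord0 * q theta x - mj * (phi x * q theta x).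
    by rewrite /phi; ring.
  rewrite (eq_Rintegral _ (fun x _ => E x)).
  rewrite RintegralB//; last exact: integrable_scale.
  by rewrite RintegralZl// phi0 mulr0 subr0.
pose S1 := \sum_j `|statistic_mean theta j|.
pose S2 := \sum_j `|statistic_cov theta i j|.
have S10 : 0 <= S1 by apply: sumr_ge0.
have S20 : 0 <= S2 by apply: sumr_ge0.
pose D := S1 + C1 * r.
have D0 : 0 <= D by rewrite addr_ge0// mulr_ge0// ltW.
have D1 : 0 < 2 * D + 1 by lra.
(* D bounds |B - 1| / |h|; the radius makes |B - 1| <= 1 / 2. *)
exists (Num.min r (2 * D + 1)^-1), (2 * (C2 + S2 * D)); split.
- by rewrite lt_min r0 invr_gt0.
- by rewrite mulr_ge0// addr_ge0// mulr_ge0.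
move=> h; rewrite le_min => /andP[hr hD].
have thh := rT h hr.
pose B := expR (psi (theta + h) - psi theta).
have B_gt0 : 0 < B by exact: expR_gt0.
have tilt (f : 'cV[R]_N -> R) : mu.-integrable setT
      (EFin \o (fun x => f x * expR (dot h (c x)) * q theta x)) ->
    B * dexpect (q (theta + h)) f =
    \int[mu]_x (f x * expR (dot h (c x)) * q theta x).
  move=> fi; rewrite /dexpect.
  have E x : f x * q (theta + h) x =
      B^-1 * (f x * expR (dot h (c x)) * q theta x).
    by rewrite q_shift -/B; ring.
  by rewrite (eq_Rintegral _ (fun x _ => E x)) RintegralZl// mulVKf// gt_eqF.
have it := integrable_tilted mc mq q0 r0 ir.
have := tilt _ (it _ _ mone one_le _ hr).
have := tilt _ (it _ _ mphi phi_le _ hr).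
have -> : dexpect (q (theta + h)) phi = statistic_mean (theta + h) i - m.
  rewrite dexpect_subr//; first exact: density_family.
  exact: integrable_statistic.
have -> : dexpect (q (theta + h)) (cst 1) = 1.
  rewrite /dexpect (eq_Rintegral _ (fun x _ => mul1r _)).
  exact/Rintegral_density/density_family.
move=> A B'; rewrite mulr1 in B'.
have := B1 h hr; have := B2 h hr; rewrite -A -B' phi0 subr0 => {A B'}.
set G := \sum_j _; set L := \sum_j _.
have GE : G = \sum_j h j ord0 * statistic_cov theta i j.
  by apply: eq_bigr => j _; rewrite phic.
have LE : L = \sum_j h j ord0 * statistic_mean theta j.
  apply: eq_bigr => j _; congr (_ * _).
  by apply: eq_Rintegral => x _; rewrite /= mul1r.
have -> : \int[mu]_x (cst 1 x * q theta x) = 1.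
  rewrite (eq_Rintegral _ (fun x _ => mul1r _)).
  exact/Rintegral_density/density_family.
rewrite -GE.
have sum_le (a : 'I_n -> R) :
    `|\sum_j h j ord0 * a j| <= `|h| * \sum_j `|a j|.
  rewrite (le_trans (ler_norm_sum _ _ _))// mulr_sumr.
  by apply: ler_sum => j _; rewrite normrM ler_wpM2r ?entry_le_norm.
have Gle : `|G| <= `|h| * S2 by rewrite GE.
have Lle : `|L| <= `|h| * S1 by rewrite LE.
move: (statistic_mean (theta + h) i - m) (normr_ge0 h) Gle Lle => X.
move: `|h| hr hD => e hr hD e0 Gle Lle HA HB.
have eD : e * D <= 1 / 2.
  have : e * (2 * D + 1) <= 1 by rewrite -ler_pdivlMr// mul1r.
  by lra.
have Bd : `|B - 1| <= e * D.
  rewrite (_ : B - 1 = (B - 1 - L) + L); last by ring.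
  rewrite (le_trans (ler_normD _ _))//.
  have : C1 * e ^+ 2 <= e * (C1 * r).
    by rewrite expr2 mulrCA ler_wpM2l// ler_wpM2l.
  by rewrite /D; lra.
have B2' : 1 / 2 <= B by move: Bd; rewrite ler_norml => /andP[]; lra.
(* X is the difference of means and G its linear part. *)
have BX : B * (X - G) = (B * X - G) - G * (B - 1) by ring.
have : `|B * (X - G)| <= C2 * e ^+ 2 + (e * S2) * (e * D).
  by rewrite BX (le_trans (ler_normB _ _))// lerD// normrM ler_pM.
rewrite normrM (gtr0_norm B_gt0) => H.
have : 1 / 2 * `|X - G| <= B * `|X - G| by rewrite ler_wpM2r.
lra.
Qed.

(** ln q_theta - ln q_theta' is an affine function of c, so it has the same mean
    under p as under q_theta, where that mean is a relative entropy. *)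
Lemma KL_moment_matching p theta theta' : is_density p ->
  (forall i, mu.-integrable setT (EFin \o (fun x => c x i ord0 * p x))) ->
  Theta theta -> Theta theta' ->
  (forall i, dexpect p (fun x => c x i ord0) = statistic_mean theta i) ->
  (KL p (q theta) <= KL p (q theta'))%E.
Proof.
move=> dp ip th th' pm.
have q0 := q_gt0.
have lE x : ln (q theta x) - ln (q theta' x) =
    dot (theta - theta') (c x) + (psi theta' - psi theta).
  by rewrite !ln_q dotBl; ring.
have [ipl epl] := dexpect_affine dp ip lE.
have iq i := integrable_statistic i th.
have [iql eql] := dexpect_affine (density_family th) iq lE.
rewrite (KL_change_of_reference dp (density_family th)
  (density_family th') (q0 theta) (q0 theta') ipl).
rewrite leeDl// lee_fin epl.
under eq_bigr => i _ do rewrite pm.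
rewrite -eql.
exact: (dexpect_ln_ratio_ge0 (density_family th) (density_family th')
  (q0 theta) (q0 theta') iql).
Qed.

Lemma mean_derivative_along D (u : R -> 'cV[R]_n) (t : R) i :
  Theta (u t) -> derivable_within D u t ->
  slope (fun s => statistic_mean (u s) i) t s @[s --> within D t^'] -->
    \sum_j derive_within D u t j ord0 * statistic_cov (u t) i j.
Proof.
move=> th du.
have [r [C [r0 _ H]]] := statistic_mean_expansion i th.
exact: (@chain_rule_within _ _ D u t (derive_within D u t)
  (fun th => statistic_mean th i) (statistic_cov (u t) i) r C r0 H du).
Qed.

End exponential_family_calculus.

(** * Mean of eigenfunctions *)

Section eigenfunctions.
Context (R : realType) (N n : nat).
Local Notation mu := (lebesgue_cV R N).

Lemma dexpect_backward_eigen (f : R -> 'cV[R]_N -> 'cV[R]_N)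
    (a : R -> 'cV[R]_N -> 'M[R]_N) (c : 'cV[R]_N -> 'cV[R]_n)
    (Lambda : 'M[R]_n) (t : R) (r : 'cV[R]_N -> R) i :
  is_diag_mx Lambda ->
  (forall x, backward_cV f a t c x = - (Lambda *m c x)) ->
  mu.-integrable setT (EFin \o (fun x => c x i ord0 * r x)) ->
  dexpect_cV r (backward_cV f a t c) i ord0 =
  - Lambda i i * dexpect r (fun x => c x i ord0).
Proof.
move=> /is_diag_mxP Lambda_diag c_eigen ir.
rewrite mxE /dexpect -RintegralZl//; apply: eq_Rintegral => x _.
rewrite c_eigen !mxE (bigD1 i)//= big1; first by rewrite addr0 !mulNr mulrA.
by move=> j ji; rewrite Lambda_diag ?mul0r// eq_sym.
Qed.

End eigenfunctions.

(** * Moments along the projected equation *)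

Theorem theorem6p6 (R : realType) (N M n : nat)
    (d : measure_display) (Om : measurableType d) (P : probability Om R)
    (f : R -> 'cV[R]_N -> 'cV[R]_N) (sigma : R -> 'cV[R]_N -> 'M[R]_(N, M))
    (W : R -> Om -> 'cV[R]_M) (X : R -> Om -> 'cV[R]_N)
    (p : R -> 'cV[R]_N -> R)
    (c : 'cV[R]_N -> 'cV[R]_n) (Theta : set 'cV[R]_n)
    (Lambda : 'M[R]_n) (theta0 : 'cV[R]_n)
    (T : \bar R) (theta : R -> 'cV[R]_n)
    (a := diffusion_mx sigma)
    (X_sde : ito_sde P f sigma W X)
    (X0_indep : independent_of_process P (X 0) W)
    (p0_pos : {ae lebesgue_cV R N, forall x, 0 < p 0 x})
    (p0_moments : finite_moments (p 0))
    (coef_regular : regular_coefficients f a)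
    (coef_growth : coercive_growth f a)
    (X_density : forall t : R, 0 <= t -> has_density P (X t) (p t))
    (p_fokker_planck : fokker_planck_solution f a p)
    (c_family : exponential_family c Theta)
    (c_finite_projection : finite_projection f a c Theta)
    (c_duality : duality_convention f a c Theta p)
    (Lambda_diag : is_diag_mx Lambda)
    (c_eigen : forall (t : R) x, 0 <= t -> backward_cV f a t c x = - (Lambda *m c x))
    (theta0_in : Theta theta0)
    (p0_theta0 : p 0 = exp_density c theta0)
    (T_pos : (0 < T)%E)
    (theta_solution : projected_solution f a c Theta theta0 T theta) :
  forall t : R, 0 <= t -> (t%:E < T)%E ->
  forall theta', Theta theta' ->
  (KL (p t) (exp_density c (theta t)) <= KL (p t) (exp_density c theta'))%E.
Proof.
move=> t t0 tT theta' th'.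
have [[openTheta _ densTheta] _ fisher_unit _] := c_family.
have [theta_0 theta_ode] := theta_solution.
have qE th x :
  exp_density c th x = expR (dot th (c x) - log_partition c th) by [].
have pdens s : 0 <= s -> is_density (p s) by move=> /X_density[].
have [Tht _ _] := theta_ode t (conj t0 tT).
apply: (KL_moment_matching qE openTheta densTheta) => //.
- exact: pdens.
- by move=> i; exact: (mean_finite c_duality).
move=> i; apply/esym/eqP; rewrite -subr_eq0; apply/eqP.
pose eta s := dexpect (p s) (fun x => c x i ord0).
pose m s := statistic_mean c (exp_density c) (theta s) i.
(* It remains to match the i-th moment, by uniqueness for y' = - Lambda i i y. *)
apply: (@linear_ode_zero _ T (fun s => m s - eta s) (- Lambda i i)) => //; last first.
  by rewrite /m /eta theta_0 p0_theta0 subrr.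
move=> s [s0 sT].
set D := [set _ | _].
have [Ths dths eths] := theta_ode s (conj s0 sT).
have dm := mean_derivative_along qE openTheta densTheta (i := i) Ths dths.
(* The Fisher matrix of the chain rule cancels its inverse in the equation. *)
have gv : \sum_j derive_within D theta s j ord0 *
    statistic_cov c (exp_density c) (theta s) i j = - Lambda i i * m s.
  transitivity ((fisher_info c (theta s) *m derive_within D theta s) i ord0).
    by rewrite mxE; apply: eq_bigr => j _; rewrite mulrC mxE.
  rewrite eths mulKVmx; last exact: fisher_unit.
  apply: (dexpect_backward_eigen Lambda_diag) => [x|]; first exact: c_eigen.
  exact: (integrable_statistic qE openTheta).
(* The derivative of the moments of p is relative to all times s >= 0, of which
   D is a subset. *)
have deta : slope eta s x @[x --> within D s^'] --> - Lambda i i * eta s.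
  have Dhalf : D `<=` @halfline R by move=> x [].
  have := derivable_within_entry (i := i) (mean_derivable c_duality s0).
  rewrite (mean_derivative_backward c_duality s0).
  rewrite (dexpect_backward_eigen Lambda_diag); last 2 first.
  - by move=> x; exact: c_eigen.
  - exact: (mean_finite c_duality).
  rewrite (_ : (fun x => dexpect_cV (p x) c i ord0) = eta); last first.
    by apply/funext => x; rewrite mxE.
  move=> h A /h; exact: within_subset.
rewrite gv in dm; rewrite mulrBr.
have dB : slope m s x - slope eta s x @[x --> within D s^'] -->
    - Lambda i i * m s - - Lambda i i * eta s by exact: cvgB.
apply: cvg_trans dB; apply: near_eq_cvg; near=> x.
rewrite /slope -mulrBr; congr (_ * _).
by move: (m x) (m s) (eta x) (eta s) => *; ring.
Unshelve. all: by end_near. Qed.
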